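(* There is an absolute constant $C>0$ such that for every prime power $q$ and all integers $n\ge 2$ and $1\le m\le n$ with $m\ge 6\log n$, writing $u=n/m$, $$\left|\frac{\mathbb{P}(f_n\text{ is }m\text{-smooth})}{\mathbb{P}(\pi_n\text{ is }m\text{-smooth})}-1\right|\le C\,\frac{u\log(u+1)}{m\,q^{\lceil\frac{m+1}{2}\rceil}} .$$
   Context: $\log$ is the natural logarithm. $\pi_n$ is a uniformly random permutation in the symmetric group $S_n$. $f_n=f_{n,q}$ is a uniformly random element of the set of monic polynomials of degree $n$ over the finite field $\mathbb{F}_q$. A permutation is $m$-smooth if all its cycles have length at most $m$. A polynomial over $\mathbb{F}_q$ is $m$-smooth if all its irreducible factors have degree at most $m$. *)

(* Defs.v *)
From HB Require Import structures.
From mathcomp Require Import all_boot all_order all_algebra all_fingroup all_field.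
From mathcomp Require Import all_classical all_reals all_analysis.
Set Implicit Arguments. Unset Strict Implicit. Unset Printing Implicit Defensive.
Import Order.TTheory GRing.Theory Num.Theory.
Local Open Scope ring_scope.

Definition uniform_prob (R : realType) (T : finType) (A : {set T})
    (P : T -> Prop) : R :=
  #|[set x in A | `[< P x >]]|%:R / #|A|%:R.

(* Fixed points are counted as cycles of length 1, as they are in [porbits]. *)
Definition smooth_perm (n m : nat) (s : {perm 'I_n}) : Prop :=
  forall c : {set 'I_n}, c \in porbits s -> (#|c| <= m)%N.

Definition smooth_poly (F : fieldType) (m : nat) (f : {poly F}) : Prop :=
  forall g : {poly F}, irreducible_poly g -> g %| f -> ((size g).-1 <= m)%N.

(* {poly_n.+1 F} is the finite type of polynomials of size at most n.+1,
   i.e. of degree at most n. *)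
Definition monic_of_degree (F : finFieldType) (n : nat) : {set {poly_n.+1 F}} :=
  [set f : {poly_n.+1 F} |
    ((f : {poly F}) \is monic) && (size (f : {poly F}) == n.+1)].

Definition prob_smooth_perm (R : realType) (n m : nat) : R :=
  uniform_prob R [set: {perm 'I_n}] (@smooth_perm n m).

Definition prob_smooth_poly (R : realType) (F : finFieldType) (n m : nat) : R :=
  uniform_prob R (monic_of_degree F n)
    (fun f => smooth_poly m (f : {poly F})).

(* Main.v *)
Require Import Defs.
From HB Require Import structures.
From mathcomp Require Import all_boot all_order all_algebra all_fingroup all_field.
From mathcomp Require Import all_classical all_reals all_analysis.
From mathcomp Require Import ring lra zify.
(* Imported last, so that unqualified set lemmas are those on finite sets. *)
From mathcomp Require Import fintype finset.
Set Implicit Arguments. Unset Strict Implicit. Unset Printing Implicit Defensive.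
Import Order.TTheory GRing.Theory Num.Theory.
Local Open Scope ring_scope.

(** Write [p n] for the probability that a random permutation of [n] points is
[m]-smooth, and [P n] for that of a random monic polynomial of degree [n]. Both
generating series are exponentials. Splitting off the cycle of a given point gives
[n p_n = \sum_(1 <= j <= m) p_(n-j)], so that
[\sum p_n X^n = exp (\sum_(j <= m) X^j / j)]. Adding up the degrees of the prime
powers dividing [f] gives [n P_n = \sum_(1 <= N <= n) b_N P_(n-N)], where
[q^N b_N] is the sum of [deg g] over the monic irreducible [g] with [deg g <= m]
and [deg g] dividing [N]. Without a bound on the degree this sum is [q^N], since
every polynomial is then smooth; hence [b_N = 1] for [1 <= N <= m]. For [N > m]
only [deg g <= N/2] contributes and [b_N <= 2 / q^(ceil (N/2))].

Consequently [P] is the Cauchy product of [p] with the nonnegative coefficients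
[e_k] of [exp (\sum_(N > m) b_N X^N / N)], and
[P_n / p_n = \sum_k e_k p_(n-k) / p_n]. It remains to bound [p_(n-k) / p_n]. The
sequence [p] is log-concave, so this quotient is at most [r^k] with
[r = p_n / p_(n+1)], and therefore
[1 <= P_n / p_n <= exp (\sum_(m < N <= n) b_N r^N / N)].

To control [r], put [X = p_(n-m) / p_n] and [Y = X^(1/m)]. By log-concavity
[p_(n-j) / p_n >= Y^j] for [j <= m], and summing over [j] turns the recurrence into
[n >= Y + ... + Y^m]. This inequality yields [X - 1 <= u ln X], whence
[X <= 4 u ln (u + 1)], and also [r <= (1 + 1/n) Y], whence [r^m <= 4 X]. Since
[X <= n <= exp (m/6)], moreover [r <= exp (1/3)] and [r^2 <= 99/50 < q]: the terms
[b_N r^N] decay geometrically, the exponent is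
[O (r^m / (m q^(ceil ((m+1)/2))))], and it is bounded. The theorem follows from
[exp s - 1 <= s exp s]. *)

(** * Exponentials of formal power series *)

Section FormalExp.
Variable R : realType.
Implicit Types a b c A B E : nat -> R.

(** When [a 0 = 0], this says that [E] lists the coefficients of the power series
[exp (\sum_(j >= 1) a_j X^j / j)]: the equation is the coefficientwise form of
[X E' = (\sum_j a_j X^j) E]. *)
Definition exp_coefs a E :=
  E 0%N = 1 /\ forall n, n%:R * E n = \sum_(j < n.+1) a j * E (n - j)%N.

(** The recurrences are only required up to [n], which lets one side be the
coefficients of a polynomial that approximates the exponential. *)
Lemma exp_coefs_uniq a E E' n : a 0%N = 0 -> E 0%N = E' 0%N ->
  (forall k, (k <= n)%N -> k%:R * E k = \sum_(j < k.+1) a j * E (k - j)%N) ->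
  (forall k, (k <= n)%N -> k%:R * E' k = \sum_(j < k.+1) a j * E' (k - j)%N) ->
  forall k, (k <= n)%N -> E k = E' k.
Proof.
move=> a0 e0 recE recE'; elim/ltn_ind => -[//|k] IH le_kn.
apply: (@mulfI _ k.+1%:R); first by rewrite pnatr_eq0.
rewrite recE // recE' //; apply: eq_bigr => -[[|j] /= lt_jk] _.
  by rewrite a0 !mul0r.
by rewrite IH //; lia.
Qed.

(** The coefficients are stored in decreasing order of index, so that entry [j]
of [exp_list a k] is the coefficient of index [k - j]. *)
Fixpoint exp_list a n : seq R :=
  if n is k.+1 then
    let l := exp_list a k in
    (k.+1%:R^-1 * \sum_(j < k.+1) a j.+1 * l`_j) :: l
  else [:: 1].

Lemma exp_coefs_exist a : a 0%N = 0 -> exists E, exp_coefs a E.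
Proof.
move=> a0; pose E n := (exp_list a n)`_0.
have nthE n j : (j <= n)%N -> (exp_list a n)`_j = E (n - j)%N.
  by elim: n j => [|n IH] [|j] //= ?; rewrite IH // subSS.
exists E; split=> // -[|n]; first by rewrite big_ord1 a0 !mul0r.
rewrite big_ord_recl a0 mul0r add0r {1}/E /= mulrA mulfV ?pnatr_eq0 // mul1r.
by apply: eq_bigr => j _; rewrite nthE /bump ?leq0n ?add1n ?subSS // -ltnS.
Qed.

Lemma coef_theta (p : {poly R}) k : ('X * p^`())`_k = k%:R * p`_k.
Proof.
by rewrite coefXM coef_deriv; case: k => [|k] /=; rewrite ?mul0r // mulr_natl.
Qed.

(** The exponential turns sums into products. The operator [X d/dX] is a
derivation, so the defining equations of [A] and [B] add up to that of their
product; everything is computed in polynomials truncated after degree [n]. *)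
Lemma exp_coefs_mul a b A B : exp_coefs a A -> exp_coefs b B ->
  exp_coefs (fun j => a j + b j) (fun n => \sum_(j < n.+1) A j * B (n - j)%N).
Proof.
move=> [A0 recA] [B0 recB]; split; first by rewrite big_ord1 A0 B0 mul1r.
move=> n; pose pol (u : nat -> R) := \poly_(i < n.+1) u i.
have conv (u v : nat -> R) k : (k <= n)%N ->
    \sum_(j < k.+1) u j * v (k - j)%N = (pol u * pol v)`_k.
  move=> le_kn; rewrite coefM; apply: eq_bigr => j _.
  by rewrite !coef_poly !ifT //; have := ltn_ord j; lia.
have thetaP (u v : nat -> R) k : (k <= n)%N ->
    (forall k, k%:R * v k = \sum_(j < k.+1) u j * v (k - j)%N) ->
    ('X * (pol v)^`())`_k = (pol u * pol v)`_k.
  by move=> le_kn rec; rewrite coef_theta -conv // -rec coef_poly ifT.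
have congM (p p' r : {poly R}) : (forall k, (k <= n)%N -> p`_k = p'`_k) ->
    (p * r)`_n = (p' * r)`_n.
  move=> eq_pp'; rewrite !coefM; apply: eq_bigr => j _.
  by rewrite eq_pp' // -ltnS.
transitivity ((pol a + pol b) * (pol A * pol B))`_n.
  rewrite conv // -coef_theta derivM mulrDr coefD mulrA.
  rewrite (congM ('X * (pol A)^`()) (pol a * pol A)); last by move=> k ?; apply: thetaP.
  rewrite ['X * (pol A * _)]mulrCA [pol A * ('X * _)]mulrC.
  rewrite (congM ('X * (pol B)^`()) (pol b * pol B)); last by move=> k ?; apply: thetaP.
  by rewrite mulrDl coefD mulrA (mulrC (pol A)) mulrA.
rewrite coefM; apply: eq_bigr => j _.
rewrite -conv; last exact: leq_subr.
by rewrite coefD !coef_poly ltn_ord.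
Qed.

(** Substitution of [x X] for [X]. *)
Lemma exp_coefs_scale a E x : exp_coefs a E ->
  exp_coefs (fun j => a j * x ^+ j) (fun j => E j * x ^+ j).
Proof.
move=> [E0 rec]; split=> [|n]; first by rewrite E0 mulr1.
rewrite mulrA rec mulr_suml; apply: eq_bigr => j _.
have le_jn : (j <= n)%N by rewrite -ltnS.
have -> : x ^+ n = x ^+ j * x ^+ (n - j) by rewrite -exprD subnKC.
by ring.
Qed.

Lemma exp_coefs_ge0 a E : (forall j, 0 <= a j) -> a 0%N = 0 -> exp_coefs a E ->
  forall n, 0 <= E n.
Proof.
move=> a_ge0 a0 [E0 rec]; elim/ltn_ind => -[|n] IH; first by rewrite E0.
rewrite -(pmulr_rge0 _ (ltr0Sn R n)) rec; apply: sumr_ge0 => -[[|j] ?] _ /=.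
  by rewrite a0 mul0r.
by rewrite mulr_ge0 // IH //; lia.
Qed.

Lemma sum_exp_le_expR (x : R) n : 0 <= x ->
  \sum_(i < n.+1) i`!%:R^-1 * x ^+ i <= expR x.
Proof.
move=> x_ge0; rewrite expRE -(big_mkord predT (fun i => i`!%:R^-1 * x ^+ i)).
rewrite (_ : pseries _ x = series (exp_coeff x)); last first.
  by apply/funext => k; rewrite /pseries exp_coeffE.
rewrite (_ : \sum_(0 <= i < n.+1) _ = series (exp_coeff x) n.+1); last first.
  by rewrite /series /= exp_coeffE; apply: eq_bigr.
apply: nondecreasing_cvgn_le; last exact: is_cvg_series_exp_coeff.
apply: nondecreasing_series => k _ _.
by rewrite exp_coeffE mulr_ge0 ?invr_ge0 ?exprn_ge0.
Qed.

(** With [Q] the truncated exponent and [T = \sum_(i <= n) Q^i / i!], the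
coefficients of [T] are nonnegative and agree with [E] up to degree [n], because
[X] divides [Q] and hence [Q^n] does not disturb the recurrence in degrees at most
[n]. So the partial sum of [E] is at most [T(1)], a partial sum of the series of
[exp (Q(1))]. *)
Lemma sum_exp_coefs_le c E n : (forall j, 0 <= c j) -> c 0%N = 0 ->
  exp_coefs c E ->
  \sum_(k < n.+1) E k <= expR (\sum_(j < n.+1) c j / j%:R).
Proof.
move=> c_ge0 c0 hE; have [E0 rec] := hE.
pose Q := \poly_(j < n.+1) (c j / j%:R).
pose T := \sum_(i < n.+1) i`!%:R^-1 *: Q ^+ i.
have Q1 : Q.[1] = \sum_(j < n.+1) c j / j%:R.
  rewrite (horner_coef_wide _ (size_poly _ _)); apply: eq_bigr => j _.
  by rewrite coef_poly ltn_ord expr1n mulr1.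
have Q_ge0 i k : 0 <= (Q ^+ i)`_k.
  elim: i k => [|i IH] k; first by rewrite expr0 coef1; case: eqP.
  rewrite exprS coefM; apply: sumr_ge0 => j _; rewrite mulr_ge0 //.
  by rewrite coef_poly; case: ifP => // _; rewrite divr_ge0.
have QX : exists Q', Q = 'X * Q'.
  exists (Q %/ 'X); rewrite mulrC divpK // -['X]subr0 -polyC0 dvdp_XsubCl.
  by rewrite /root horner_coef0 coef_poly /= c0 mul0r.
have Qn_lo i k : (k < i)%N -> (Q ^+ i)`_k = 0.
  have [Q' ->] := QX; move=> lt_ki.
  by rewrite exprMn coefXnM lt_ki.
have dT : T^`() = Q^`() * (T - n`!%:R^-1 *: Q ^+ n).
  rewrite {2}/T big_ord_recr /= addrK /T raddf_sum /= big_ord_recl /=.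
  rewrite expr0 derivZ -[X in X^`()]polyC1 derivC scaler0 add0r mulr_sumr.
  apply: eq_bigr => i _; rewrite derivZ deriv_exp /= /bump leq0n add1n.
  rewrite add0n -[Q^`() * _ *+ _]scaler_nat scalerA -scalerAr; congr (_ *: _).
  by rewrite factS natrM invfM mulrAC mulVf ?mul1r // pnatr_eq0.
have T0 : T`_0 = 1.
  rewrite /T coef_sum big_ord_recl /= coefZ expr0 coef1 fact0 invr1 mul1r.
  rewrite big1 ?addr0 // => i _; rewrite coefZ Qn_lo ?mulr0 //.
have recT k : (k <= n)%N -> k%:R * T`_k = \sum_(j < k.+1) c j * T`_(k - j)%N.
  move=> le_kn; rewrite -coef_theta dT mulrA coefM; apply: eq_bigr => j _.
  rewrite coef_theta coefB coefZ coef_poly; have := ltn_ord j.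
  case: j => -[|j] /= _ lt_jk; first by rewrite c0 !mul0r.
  rewrite ifT; last lia.
  rewrite Qn_lo ?mulr0 ?subr0; last lia.
  by rewrite mulrCA mulfV ?mulr1 // pnatr_eq0.
have ET k : (k <= n)%N -> E k = T`_k.
  by apply: (exp_coefs_uniq (a := c)) => //; rewrite E0.
have T_ge0 k : 0 <= T`_k.
  by rewrite coef_sum; apply: sumr_ge0 => i _; rewrite coefZ mulr_ge0 ?invr_ge0.
apply: (@le_trans _ _ T.[1]).
  rewrite (horner_coef_wide _ (leq_maxl (size T) n.+1)).
  rewrite -(big_mkord predT (fun k => T`_k * 1 ^+ k)).
  rewrite (@big_cat_nat _ _ _ n.+1) //= ?leq_maxr //.
  rewrite big_mkord ler_wpDr //.
    by apply: sumr_ge0 => k _; rewrite expr1n mulr1.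
  by apply: ler_sum => k _; rewrite expr1n mulr1 ET // -ltnS.
rewrite /T horner_sum -Q1.
under eq_bigr => i _ do rewrite hornerZ horner_exp.
apply: sum_exp_le_expR; rewrite Q1; apply: sumr_ge0 => j _; exact: divr_ge0.
Qed.

End FormalExp.

(** * Smooth permutations *)

Section Permutations.
Variable T : finType.
Implicit Types (s t : {perm T}) (A B C : {set T}).
Local Open Scope nat_scope.

(** Only the cycles through points of [A] are constrained: the points outside [A]
are fixed, and their trivial cycles do not count. *)
Definition smooth_on m A : {set {perm T}} :=
  [set s | perm_on A s && [forall x in A, #|porbit s x| <= m]].

(** For [x] in [C], these are the cyclic permutations of [C]. *)
Definition cycles_through x C : {set {perm T}} :=
  [set s | perm_on C s && (porbit s x == C)].

Lemma eq_porbit B s t x : {in B, s =1 t} -> {in B, forall y, s y \in B} ->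
  x \in B -> porbit s x = porbit t x.
Proof.
move=> eq_st sB xB.
have step i : (s ^+ i)%g x \in B /\ (s ^+ i)%g x = (t ^+ i)%g x.
  elim: i => [|i [iB eqi]]; first by rewrite !expg0 perm1.
  by rewrite !expgSr !permM -eqi -eq_st ?sB.
by apply/setP => y; apply/porbitP/porbitP => -[i ->]; exists i; rewrite (step i).2.
Qed.

Lemma porbit_sub A s x : perm_on A s -> x \in A -> porbit s x \subset A.
Proof.
move=> sA xA; apply/subsetP => y /porbitP[i ->].
elim: i => [|i IH]; first by rewrite expg0 perm1.
by rewrite expgSr permM (perm_closed _ sA).
Qed.

Lemma porbit_stable s x y : (s y \in porbit s x) = (y \in porbit s x).
Proof. by rewrite ![_ \in porbit s x]porbit_sym -{2}[s]expg1 porbit_perm. Qed.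

Section Disjoint.
Variables (C D : {set T}) (c d : {perm T}).
Hypotheses (dCD : [disjoint C & D]) (cC : perm_on C c) (dD : perm_on D d).

Lemma disjoint_mull y : y \in C -> (c * d)%g y = c y.
Proof.
move=> yC; rewrite permM (out_perm dD) //.
by rewrite (disjointFr dCD) // perm_closed.
Qed.

Lemma disjoint_mulr y : y \notin C -> (c * d)%g y = d y.
Proof. by move=> yC; rewrite permM (out_perm cC). Qed.
End Disjoint.

(** A permutation of [A] whose cycle through [x] is [C] is uniquely the product of
a cyclic permutation of [C] and a permutation of [A :\: C], and smoothness only
constrains the second factor. *)
Lemma card_smooth_fiber m A C x : x \in C -> C \subset A -> #|C| <= m ->
  #|[set s in smooth_on m A | porbit s x == C]|
  = #|cycles_through x C| * #|smooth_on m (A :\: C)|.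
Proof.
move=> xC sCA leCm; set D := A :\: C.
have dCD : [disjoint C & D].
  by rewrite disjoints_subset; apply/subsetP => y yC; rewrite !inE yC.
have sDA : D \subset A by exact: subsetDl.
rewrite -cardsX -(card_in_imset (f := fun u : {perm T} * {perm T} => (u.1 * u.2)%g)).
  apply: eq_card => s; apply/idP/imsetP => [|[[c d]]]; last first.
    rewrite inE /= !inE => /andP[/andP[cC /eqP cxC] /andP[dD /forall_inP smd]] ->.
    have cdC : {in C, (c * d)%g =1 c} by move=> y; apply: disjoint_mull dD _.
    have cdD : {in D, (c * d)%g =1 d}.
      move=> y yD; apply: (disjoint_mulr _ cC).
      by rewrite (disjointFl dCD yD).
    have orbC y : y \in C -> porbit (c * d) y = porbit c y.
      move=> yC; apply: (eq_porbit (B := C)) => // z zC.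
      by rewrite cdC // perm_closed.
    rewrite orbC // cxC eqxx andbT; apply/andP; split.
      apply: perm_onM; first exact: subset_trans cC sCA.
      exact: subset_trans dD sDA.
    apply/forall_inP => y yA; have [yC|yNC] := boolP (y \in C).
      rewrite orbC //; apply: leq_trans leCm; apply: subset_leq_card.
      exact: porbit_sub.
    have yD : y \in D by rewrite inE yNC.
    rewrite (@eq_porbit D _ d) ?smd // => z zD.
    by rewrite cdD // perm_closed.
  rewrite !inE => /andP[/andP[sA /forall_inP sms] /eqP sxC].
  have sC y : (s y \in C) = (y \in C) by rewrite -sxC porbit_stable.
  (* the first factor is the restriction of s to its orbit C *)
  pose c := restr_perm C s.
  have sN : s \in 'N(C | 'P)%g.
    by apply/astabsP => y /=; rewrite apermE sC.
  have cE y : y \in C -> c y = s y by move=> yC; apply: restr_permE.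
  have cC : perm_on C c by apply: restr_perm_on.
  have dE y : y \notin C -> (c^-1 * s)%g y = s y.
    by move=> yC; rewrite permM (out_perm (perm_onV cC)).
  have dC y : y \in C -> (c^-1 * s)%g y = y.
    move=> yC; rewrite permM -cE ?permKV //.
    by rewrite (perm_closed _ (perm_onV cC)).
  exists (c, c^-1 * s)%g; last by rewrite /= mulKVg.
  rewrite inE /= !inE cC /=; apply/and3P; split.
  - rewrite -(@eq_porbit C s) ?sxC // => y yC; last by rewrite sC.
    by rewrite cE.
  - apply/subsetP => y; rewrite !inE; apply: contraR.
    rewrite negb_and negbK => /orP[yC|yA]; first by rewrite dC.
    by rewrite dE ?(out_perm sA) //; apply: contra yA => /(subsetP sCA).
  - apply/forall_inP => y yD; have := yD; rewrite inE => /andP[yC yA].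
    rewrite -(@eq_porbit (~: C) s) ?sms //; last by rewrite inE.
      by move=> z; rewrite inE => zC; rewrite dE.
    by move=> z; rewrite !inE sC.
move=> [c d] [c' d']; rewrite inE /= !inE /=.
move=> /andP[/andP[cC _] /andP[dD _]] /andP[/andP[c'C _] /andP[d'D _]] eq_cd.
suff eq_c : c = c' by move: eq_cd; rewrite eq_c => /mulgI ->.
apply/permP => y; have [yC|yNC] := boolP (y \in C).
  by rewrite -(disjoint_mull dCD cC dD yC) eq_cd (disjoint_mull dCD c'C d'D).
by rewrite !(@out_perm _ C).
Qed.

Lemma card_smooth_on_rec m A x : x \in A ->
  #|smooth_on m A| = \sum_(C : {set T} | [&& x \in C, C \subset A & #|C| <= m])
    #|cycles_through x C| * #|smooth_on m (A :\: C)|.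
Proof.
move=> xA; rewrite -sum1_card.
rewrite (partition_big (fun s => porbit s x)
  (fun C : {set T} => [&& x \in C, C \subset A & #|C| <= m])) /=.
  apply: eq_bigr => C /and3P[xC sCA leCm].
  rewrite -card_smooth_fiber // -sum1_card.
  by apply: eq_bigl => s; rewrite inE.
move=> s; rewrite inE => /andP[sA /forall_inP sms].
by rewrite porbit_id porbit_sub // sms.
Qed.

Lemma smooth_on_all m A : #|A| <= m -> #|smooth_on m A| = (#|A|)`!.
Proof.
move=> leAm; rewrite -card_perm; apply: eq_card => s; rewrite inE.
apply: andb_idr => sA; apply/forall_inP => x xA.
exact: leq_trans (subset_leq_card (porbit_sub sA xA)) leAm.
Qed.

(** The subsets of [A] that contain [x] correspond to the subsets of [A :\ x]. *)
Lemma sum_pointed_subsets (V : nmodType) A x (F : nat -> V) : x \in A ->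
  (\sum_(C : {set T} | (x \in C) && (C \subset A)) F #|C|
  = \sum_(j < #|A|) F j.+1 *+ 'C(#|A|.-1, j))%R.
Proof.
move=> xA; pose n := #|A :\ x|.
have cardA : #|A| = n.+1 by rewrite (cardsD1 x) xA.
rewrite (reindex_onto (fun D => x |: D) (fun C => C :\ x)) /=; last first.
  by move=> C /andP[xC _]; rewrite setD1K.
rewrite (partition_big (fun D : {set T} => inord #|D| : 'I_n.+1) predT) //= cardA.
apply: eq_bigr => j _.
have small (D : {set T}) : D \subset A :\ x ->
    (inord #|D| : 'I_n.+1) = #|D| :> nat.
  by move=> sD; apply: inordK; rewrite ltnS /n; apply: subset_leq_card.
rewrite /= -cards_draws -sumr_const; apply: congr_big => // [D|D].
  rewrite !inE eqxx /=; have [xD|xD] /= := boolP (x \in D).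
    have -> : ((x |: D) :\ x == D) = false.
      by apply/eqP => eqD; move: xD; rewrite -eqD !inE eqxx.
    by rewrite andbF subsetD1 xD andbF.
  rewrite setU1K // eqxx andbT subUset sub1set xA /= subsetD1 xD andbT.
  have [sDA|//] := boolP (D \subset A).
  by rewrite -val_eqE /= small // subsetD1 sDA.
rewrite setU11 /= => /andP[/andP[sDA /eqP eqD] /eqP <-].
have xD : x \notin D by rewrite -eqD !inE eqxx.
rewrite small ?cardsU1 ?xD // -eqD setSD //.
Qed.

(** Cycles need not be enumerated: the decomposition of all [#|A|!] permutations of
[A] by the cycle of [x] determines the number of cyclic ones by induction, and
[(#|C|.-1)!] satisfies the same identity. *)
Lemma card_cycles_through A x : x \in A -> #|cycles_through x A| = (#|A|.-1)`!.
Proof.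
have [n] := ubnP #|A|; elim: n A => // n IH A; rewrite ltnS => leAn xA.
pose P C := (x \in C) && (C \subset A).
pose G k := (k.-1)`! * (#|A| - k)`!.
have cardD C : P C -> #|A :\: C| = #|A| - #|C|.
  by case/andP=> _ sCA; rewrite cardsD (setIidPr sCA).
have sumG : \sum_(C : {set T} | P C) G #|C| = (#|A|)`!.
  rewrite (sum_pointed_subsets G xA) /G.
  rewrite (eq_bigr (fun=> (#|A|.-1)`!)); last first.
    move=> j _; have := ltn_ord j; case: #|A| j => //= k j lt_jk.
    by rewrite subSS -(bin_fact (m := j) (n := k)) // -mulr_natl natn.
  rewrite sum_nat_const card_ord.
  have : 0 < #|A| by apply/card_gt0P; exists x.
  by case: #|A| => // k _; rewrite factS.
have PA : P A by rewrite /P xA subxx.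
have allN C : P C -> #|smooth_on #|A| (A :\: C)| = (#|A| - #|C|)`!.
  by move=> PC; rewrite smooth_on_all ?cardD ?leq_subr.
have := card_smooth_on_rec #|A| xA.
rewrite smooth_on_all // (eq_bigl P); last first.
  move=> C; rewrite /P; case: (x \in C) => //=.
  by case: (boolP (C \subset A)) => // /subset_leq_card ->.
rewrite -sumG (bigD1 A) //= [RHS](bigD1 A) //= allN // /G subnn !muln1 => /eqP.
rewrite (eq_bigr (fun C => #|cycles_through x C| * #|smooth_on #|A| (A :\: C)|)).
  by rewrite eqn_add2r => /eqP.
move=> C /andP[PC neqCA]; rewrite allN // IH //; last by case/andP: PC.
case/andP: PC => _ sCA; apply: leq_trans leAn; apply: proper_card.
by rewrite properEneq neqCA.
Qed.

(** Among the [n!] permutations of an [n]-set, each size [j] of the cycle of [x]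
contributes ['C(n-1, j-1) * (j-1)! * (n-j)! p_(n-j) = (n-1)! p_(n-j)] smooth ones,
which is the recurrence of [p]. *)
Lemma card_smooth_on (R : realType) m (p : nat -> R) :
  exp_coefs (fun j => (0 < j <= m)%N%:R%R) p ->
  forall A, (#|smooth_on m A|%:R = (#|A|)`!%:R * p #|A|)%R.
Proof.
move=> [p0 rec] A; have [n] := ubnP #|A|; elim: n A => // n IH A; rewrite ltnS => leAn.
have [->|[x xA]] := set_0Vmem A.
  by rewrite smooth_on_all cards0 // p0 mulr1.
rewrite (card_smooth_on_rec m xA) natr_sum.
pose F k : R := ((k <= m)%N%:R * (k.-1)`!%:R * (#|A| - k)%N`!%:R * p (#|A| - k)%N)%R.
transitivity (\sum_(C : {set T} | (x \in C) && (C \subset A)) F #|C|)%R.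
  rewrite big_mkcond [RHS]big_mkcond /=; apply: eq_bigr => C _.
  case: (boolP (x \in C)) => //= xC; case: (boolP (C \subset A)) => //= sCA.
  rewrite /F; case: leqP => _; last by rewrite !mul0r.
  have cardD : #|A :\: C| = #|A| - #|C| by rewrite cardsD (setIidPr sCA).
  have C_gt0 : 0 < #|C| by apply/card_gt0P; exists x.
  have leCA := subset_leq_card sCA.
  rewrite card_cycles_through // natrM IH; last by rewrite cardD; lia.
  by rewrite cardD mul1r mulrA.
rewrite (sum_pointed_subsets F xA) /F.
have : 0 < #|A| by apply/card_gt0P; exists x.
case: #|A| => // k _; rewrite factS mulnC natrM -mulrA rec mulr_sumr.
rewrite [RHS]big_ord_recl /= mul0r mulr0 add0r; apply: eq_bigr => j _.
have lejk : j <= k by rewrite -ltnS.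
rewrite /= /bump leq0n add1n subSS -(bin_fact lejk) !natrM -mulr_natl; ring.
Qed.

End Permutations.

Lemma prob_smooth_permE (R : realType) n m (p : nat -> R) :
  exp_coefs (fun j => (0 < j <= m)%N%:R) p -> prob_smooth_perm R n m = p n.
Proof.
move=> hp; rewrite /prob_smooth_perm /Defs.uniform_prob.
have -> : #|[set: {perm 'I_n}]| = n`! by rewrite cardsT card_Sn.
have := card_smooth_on hp [set: 'I_n]; rewrite cardsT card_ord.
have -> : #|smooth_on m [set: 'I_n]| =
    #|[set s in [set: {perm 'I_n}] | `[< smooth_perm m s >]]|.
  apply: eq_card => s; rewrite !inE /=.
  have -> : perm_on [set: 'I_n] s by apply/subsetP => y; rewrite inE.
  apply/forall_inP/asboolP => [sms c /imsetP[y _ ->]|sms y _].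
    by apply: sms; rewrite inE.
  by apply: sms; apply: imset_f.
move=> ->; rewrite mulrAC mulfV ?mul1r // pnatr_eq0 -lt0n; exact: fact_gt0.
Qed.

(** * Smooth polynomials over a finite field *)

Section IrreducibleFactors.
Variable F : fieldType.
Implicit Types f g h : {poly F}.

Lemma irred_dvd_mul g f h : irreducible_poly g -> g %| f * h = (g %| f) || (g %| h).
Proof.
move=> irr_g; apply/idP/orP; last by case=> ?; [apply: dvdp_mulr|apply: dvdp_mull].
move=> dvd_g; have [|ndvd] := boolP (g %| f); [by left|right].
by move: dvd_g; rewrite Gauss_dvdpr // irreducible_poly_coprime.
Qed.

Lemma exists_irred_factor f : (1 < size f)%N ->
  exists h, [/\ irreducible_poly h, h \is monic & h %| f].
Proof.
have [n] := ubnP (size f); elim: n f => // n IH f lt_fn f_gt1.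
have f0 : f != 0 by rewrite -size_poly_gt0 ltnW.
have [irr_f|] := pselect (irreducible_poly f).
  have lc0 : (lead_coef f)^-1 != 0 by rewrite invr_eq0 lead_coef_eq0.
  have eqf := eqp_scale f lc0.
  exists ((lead_coef f)^-1 *: f); split.
  - split=> [|q q1]; first by rewrite size_scale.
    by rewrite (eqp_dvdr _ eqf) (eqp_rtrans eqf) => /irr_f; apply.
  - by rewrite monicE lead_coefZ mulVf ?lead_coef_eq0.
  - by rewrite (eqp_dvdl _ eqf).
move=> nirr; have [g [g1 gf ngf]] : exists g, [/\ size g != 1, g %| f & ~~ (g %= f)].
  apply: contra_notP nirr => nex; split=> // g g1 gf; apply: contra_notT nex => ngf.
  by exists g.
have g0 : g != 0 by apply: contraTneq gf => ->; rewrite dvd0p.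
have lt_gf : (size g < size f)%N.
  by rewrite ltn_neqAle dvdp_size_eqp // ngf dvdp_leq.
have [||h [irr_h mon_h hg]] := IH g.
- exact: leq_trans lt_gf _.
- by rewrite ltn_neqAle eq_sym g1 size_poly_gt0.
- by exists h; split=> //; apply: dvdp_trans gf.
Qed.

Lemma smooth_poly_dvd m f g : g %| f -> smooth_poly m f -> smooth_poly m g.
Proof. by move=> gf smf h irr_h hg; apply: smf => //; apply: dvdp_trans gf. Qed.

Lemma smooth_polyM m f g : smooth_poly m f -> smooth_poly m g -> smooth_poly m (f * g).
Proof.
move=> smf smg h irr_h; rewrite irred_dvd_mul // => /orP[]; [exact: smf|exact: smg].
Qed.

Lemma smooth_irred_exp m g j : irreducible_poly g -> (0 < j)%N ->
  `[< smooth_poly m (g ^+ j) >] = ((size g).-1 <= m)%N.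
Proof.
move=> irr_g j0; apply/asboolP/idP => [|le_gm]; first by apply=> //; exact: dvdp_exp.
elim: j j0 => // -[|j] IH _.
  by move=> h irr_h; rewrite expr1 => hg; rewrite (eqp_size (irr_g _ _ hg)) //;
    rewrite gtn_eqF //; case: irr_h.
rewrite exprS; apply: smooth_polyM (IH _) => //; move=> h irr_h hg.
by rewrite (eqp_size (irr_g _ _ hg)) // gtn_eqF //; case: irr_h.
Qed.

Lemma smooth_poly_deg m f : f != 0 -> ((size f).-1 <= m)%N -> smooth_poly m f.
Proof.
by move=> f0 lefm g _ /(dvdp_leq f0) legf; apply: leq_trans lefm; rewrite -!subn1 leq_sub2r.
Qed.

End IrreducibleFactors.

Section Monics.
Variable F : finFieldType.
Implicit Types f g h : {poly F}.
Local Notation q := #|F|.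

(** A list of plain polynomials, so that different degrees can be compared without
changing the type. *)
Definition monics n : seq {poly F} :=
  [seq (f : {poly F}) | f : {poly_n.+1 F} <- enum (monic_of_degree F n)].

Definition irreducibles k : seq {poly F} := [seq g <- monics k | irreducibleb g].

Definition smoothb m f := `[< smooth_poly m f >].

Definition nb_smooth m n := count (smoothb m) (monics n).

(** The sum of [deg g] over the prime powers [g ^+ j] of degree [N] with [g] monic
irreducible of degree at most [m]: the von Mangoldt weight restricted to smooth
polynomials. *)
Definition prime_weight m N : nat :=
  ((0 < N) * \sum_(k < m.+1) (k %| N) * (k * size (irreducibles k)))%N.

Lemma mem_monics n f : (f \in monics n) = (f \is monic) && (size f == n.+1).
Proof.
apply/mapP/andP => [[g]|[mon_f /eqP sz_f]].
  by rewrite mem_enum inE => /andP[? ?] ->.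
exists (npolyp n.+1 f); last by rewrite npolypK ?sz_f.
by rewrite mem_enum inE npolypK ?sz_f // mon_f eqxx.
Qed.

Lemma monics_uniq n : uniq (monics n).
Proof. by rewrite map_inj_uniq ?enum_uniq //; apply: val_inj. Qed.

Lemma size_monics n : size (monics n) = (q ^ n)%N.
Proof.
pose shift (g : {poly_n F}) : {poly F} := 'X^n + (g : {poly F}).
rewrite -card_npoly cardE -(size_map shift).
apply/perm_size/uniq_perm; first exact: monics_uniq.
  by rewrite map_inj_uniq ?enum_uniq // => g g' /addrI /val_inj.
move=> f; rewrite mem_monics.
apply/andP/mapP => [[mon_f /eqP sz_f]|[g _ ->]].
  have sz : (size (f - 'X^n)%R <= n)%N.
    apply/leq_sizeP => j le_nj; rewrite coefB coefXn.
    move: le_nj; rewrite leq_eqVlt => /predU1P[<-|lt_nj].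
      by move/monicP: mon_f; rewrite lead_coefE sz_f /= => ->; rewrite eqxx subrr.
    by rewrite nth_default ?sz_f // gtn_eqF ?subr0.
  by exists (npolyp n (f - 'X^n)); rewrite ?mem_enum // /shift npolypK // addrC subrK.
have lt_g : (size (g : {poly F}) < size ('X^n : {poly F}))%N.
  by rewrite size_polyXn ltnS size_npoly.
by rewrite /shift monicE lead_coefDl // lead_coefXn size_polyDl // size_polyXn !eqxx.
Qed.

Lemma mem_irreducibles k g : g \in irreducibles k ->
  [/\ irreducible_poly g, g \is monic & size g = k.+1].
Proof.
by rewrite mem_filter mem_monics => /and3P[/irreducibleP ? ? /eqP].
Qed.

(** The degree of [f] is the sum of the degrees of its prime factors, and the
multiplicity of [g] in [f] is the number of [j >= 1] such that [g ^+ j] divides [f].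
Removing one irreducible factor [h] from [f] removes exactly one such [j], for
[g = h]. The bound [L] is independent of [f], as the induction requires. *)
Lemma degree_sum L n f : f \in monics n -> (n < L)%N ->
  n = (\sum_(k < L) \sum_(g <- irreducibles k) \sum_(j < L | 0 < j)
        k * (g ^+ j %| f)%R)%N.
Proof.
elim/ltn_ind: n f => n IH f; rewrite mem_monics => /andP[mon_f /eqP sz_f] lt_nL.
have [n0|n_gt0] := posnP n.
  rewrite {1}n0 big1 // => -[[|k] lt_k] _ /=; first by rewrite big1 // => *; rewrite big1.
  rewrite big_seq big1 // => g /mem_irreducibles[irr_g mon_g sz_g].
  rewrite big1 // => j j0; have/eqP := sz_f; rewrite n0 size_poly_eq1 => /eqp_dvdr ->.
  have -> : (g ^+ j %| 1) = false; last by rewrite muln0.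
  apply/negbTE; rewrite dvdp1 -(prednK (n := size _)) ?size_exp ?sz_g; last first.
    by rewrite size_poly_gt0 monic_neq0 ?monic_exp.
  by rewrite eqSS muln_eq0 /= -lt0n.
have [|h [irr_h mon_h /dvdpP[f' def_f]]] := @exists_irred_factor _ f.
  by rewrite sz_f.
have mon_f' : f' \is monic by move: mon_f; rewrite def_f monicMr.
pose e := (size h).-1.
have sz_h : size h = e.+1 by rewrite /e prednK // size_poly_gt0 monic_neq0.
have e_gt0 : (0 < e)%N by case: irr_h; rewrite sz_h.
have sz_f' : size f' = (n - e).+1 /\ (e <= n)%N.
  have := sz_f; rewrite def_f size_Mmonic ?monic_neq0 // sz_h.
  have : (0 < size f')%N by rewrite size_poly_gt0 monic_neq0.
  by case: (size f') => // d _; lia.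
case: sz_f' => sz_f' le_en.
have f'P : f' \in monics (n - e) by rewrite mem_monics mon_f' sz_f' /=.
have {}IH := IH (n - e)%N _ f' f'P _.
have h_irr : h \in irreducibles e.
  by rewrite mem_filter mem_monics mon_h sz_h eqxx !andbT; apply/irreducibleP.
have step k g : g \in irreducibles k ->
    (\sum_(j < L | 0 < j) k * (g ^+ j %| f)%R =
     k * (g == h) + \sum_(j < L | 0 < j) k * (g ^+ j %| f')%R)%N.
  move=> /mem_irreducibles[irr_g mon_g sz_g].
  have [->|neq_gh] := eqVneq g h; last first.
    rewrite muln0 add0n; apply: eq_bigr => j _; rewrite def_f Gauss_dvdpl //.
    rewrite coprimep_expl // irreducible_poly_coprime //.
    apply: contra neq_gh => gh; rewrite -eqp_monic //; apply: irr_h gh.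
    by rewrite gtn_eqF //; case: irr_g.
  case: L lt_nL {IH} => // L lt_nL.
  rewrite big_mkcond big_ord_recl /= add0n [X in (_ + X)%N]big_mkcond.
  rewrite [X in (_ + X)%N]big_ord_recl /= add0n muln1.
  transitivity (\sum_(j < L.+1) k * (h ^+ j %| f')%R)%N.
    rewrite [RHS]big_ord_recr /= [X in (k * X)%N](_ : _ = 0)%N ?muln0 ?addn0.
      apply: eq_bigr => j _; rewrite def_f /bump leq0n add1n exprSr.
      by rewrite dvdp_mul2r ?monic_neq0.
    apply/eqP; rewrite eqb0; apply/negP => /(dvdp_leq (monic_neq0 mon_f')).
    rewrite sz_f' -(prednK (n := size (h ^+ L))) ?size_poly_gt0 ?monic_neq0 ?monic_exp //.
    rewrite size_exp sz_h ltnS /=; nia.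
  by rewrite big_ord_recl /= expr0 dvd1p muln1.
rewrite (eq_bigr (fun k : 'I_L => \sum_(g <- irreducibles k) k * (g == h) +
   \sum_(g <- irreducibles k) \sum_(j < L | 0 < j) k * (g ^+ j %| f')%R)%N).
  rewrite big_split /= -IH; [|lia..].
  rewrite (bigD1 (Ordinal (leq_ltn_trans le_en lt_nL))) //= [X in (_ + X + _)%N]big1.
    rewrite (bigD1_seq h) //=; last by rewrite filter_uniq ?monics_uniq.
    rewrite eqxx muln1 big1; first lia.
    by move=> g /negbTE ->; rewrite muln0.
  move=> k /eqP neq_ke; rewrite big_seq big1 // => g /mem_irreducibles[_ _ sz_g].
  have [eq_gh|] := eqVneq g h; last by rewrite muln0.
  by case: neq_ke; apply: val_inj => /=; rewrite /e -eq_gh sz_g.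
move=> k _; rewrite -big_split /= big_seq [RHS]big_seq; apply: eq_bigr => g.
exact: step.
Qed.

Lemma count_smooth_multiples m n d h : h \is monic -> size h = d.+1 ->
  count (fun f => smoothb m f && (h %| f)) (monics n) =
  ((smoothb m h && (d <= n)) * nb_smooth m (n - d))%N.
Proof.
move=> mon_h sz_h; have h0 := monic_neq0 mon_h.
have [smh|nsmh] /= := boolP (smoothb m h); last first.
  rewrite (eq_count (a2 := pred0)) ?count_pred0 // => f /=.
  apply/negP => /andP[/asboolP smf hf]; case/negP: nsmh; apply/asboolP.
  exact: smooth_poly_dvd smf.
have [le_dn|lt_nd] := leqP d n; last first.
  rewrite mul0n; apply/eqP; rewrite -leqn0 leqNgt -has_count -all_predC.
  apply/allP => f; rewrite mem_monics => /andP[/monic_neq0 f0 /eqP sz_f] /=.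
  rewrite negb_and orbC; apply/orP; left; apply/negP => /(dvdp_leq f0).
  by rewrite sz_f sz_h ltnS leqNgt lt_nd.
rewrite mul1n -size_filter /nb_smooth -size_filter -[RHS](size_map (fun f => f * h)).
apply/perm_size/uniq_perm; first by rewrite filter_uniq ?monics_uniq.
  rewrite map_inj_uniq ?filter_uniq ?monics_uniq //; exact: mulIf.
move=> f; rewrite mem_filter mem_monics.
apply/idP/mapP => [/andP[/andP[/asboolP smf /dvdpP[f' def_f]] /andP[mon_f /eqP sz_f]]|].
  have mon_f' : f' \is monic by move: mon_f; rewrite def_f monicMr.
  exists f' => //; rewrite mem_filter mem_monics mon_f'; apply/andP; split.
    by apply/asboolP; apply: smooth_poly_dvd smf; rewrite def_f dvdp_mulr.
  have := sz_f; rewrite def_f size_Mmonic ?monic_neq0 // sz_h addnS /= => szD.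
  by rewrite -(eqn_add2r d) szD addSn subnK.
move=> [f']; rewrite mem_filter mem_monics => /and3P[/asboolP smf' mon_f' /eqP sz_f'] ->.
rewrite monicMr // mon_f' dvdp_mull // size_Mmonic ?monic_neq0 // sz_f' sz_h.
rewrite !andbT addSn addnS /= subnK // eqxx andbT.
by apply/asboolP; apply: smooth_polyM => //; apply/asboolP.
Qed.

Lemma sum_multiples L n k (G : nat -> nat) : (0 < k)%N -> (n < L)%N ->
  (\sum_(j < L | 0 < j) (j * k <= n) * G (j * k) =
   \sum_(N < n.+1) (0 < N) * (k %| N) * G N)%N.
Proof.
move=> k0 lt_nL.
transitivity (\sum_(j < L | 0 < j) \sum_(N < n.+1) (N == j * k :> nat) * G N)%N.
  apply: eq_bigr => j _; case: leqP => [le_jk|lt_jk]; last first.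
    rewrite mul0n big1 // => N _; rewrite ltn_eqF ?mul0n //.
    by have := ltn_ord N; rewrite ltnS => /leq_ltn_trans; apply.
  rewrite (bigD1 (Ordinal (le_jk : j * k < n.+1)%N)) //= eqxx big1 ?addn0 //.
  move=> N /eqP neqN; case: eqP => // eqN; case: neqN; exact: val_inj.
rewrite exchange_big /=; apply: eq_bigr => N _; rewrite -big_distrl /=; congr (_ * _)%N.
have [/dvdnP[d def_N]|ndvd] := boolP (k %| N)%N; last first.
  rewrite muln0 big1 // => j _; case: eqP => // eqN.
  by rewrite eqN dvdn_mull in ndvd.
rewrite muln1; have [N0|N_gt0] := posnP N.
  rewrite big1 // => j j0; case: eqP => // eqN.
  have: (0 < j * k)%N by rewrite muln_gt0 j0.
  by rewrite -eqN N0.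
have d0 : (0 < d)%N by move: N_gt0; rewrite def_N muln_gt0 => /andP[].
have lt_dL : (d < L)%N.
  have := ltn_ord N; rewrite def_N; nia.
rewrite (bigD1 (Ordinal lt_dL)) //= -def_N eqxx big1 // => j /andP[_ /eqP neq_jd].
case: eqP => // eqN; case: neq_jd; apply: val_inj => /=.
by apply/eqP; rewrite -(eqn_pmul2r k0) -def_N -eqN.
Qed.

(** Sum [degree_sum] over the smooth [f] of degree [n] and exchange the sums: the
smooth [f] divisible by a smooth [g ^+ j] are the products of [g ^+ j] with the
smooth polynomials of the complementary degree. *)
Lemma nb_smooth_rec m n :
  (n * nb_smooth m n =
   \sum_(N < n.+1) prime_weight m N * nb_smooth m (n - N))%N.
Proof.
pose L := (n + m).+1; pose w k := size (irreducibles k).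
have lt_nL : (n < L)%N by rewrite ltnS leq_addr.
transitivity (\sum_(f <- monics n | smoothb m f) \sum_(k < L)
  \sum_(g <- irreducibles k) \sum_(j < L | 0 < j) k * (g ^+ j %| f)%R)%N.
  rewrite /nb_smooth -sum1_count big_distrr /= big_seq_cond [RHS]big_seq_cond.
  by apply: eq_bigr => f /andP[fP _]; rewrite muln1 -(degree_sum fP lt_nL).
rewrite exchange_big /=.
transitivity (\sum_(k < L) (k <= m) * (k * w k *
    \sum_(j < L | 0 < j) (j * k <= n) * nb_smooth m (n - j * k)))%N.
  apply: eq_bigr => k _; rewrite exchange_big /= big_seq.
  rewrite (eq_bigr (fun=> (k <= m) * (k *
    \sum_(j < L | 0 < j) (j * k <= n) * nb_smooth m (n - j * k))))%N.
    rewrite -big_seq big_const_seq count_predT iter_addn_0 /w; ring.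
  move=> g /mem_irreducibles[irr_g mon_g sz_g]; rewrite exchange_big !big_distrr /=.
  apply: eq_bigr => j j0; rewrite -big_distrr /= mulnCA; congr (_ * _)%N.
  rewrite -[(k <= m)%N]/(k.+1.-1 <= m)%N -sz_g -(smooth_irred_exp _ irr_g j0).
  rewrite mulnA mulnb -(count_smooth_multiples m n (h := g ^+ j)) ?monic_exp //; last first.
    rewrite -(prednK (n := size _)) ?size_exp ?sz_g ?[(j * k)%N]mulnC //.
    by rewrite size_poly_gt0 monic_neq0 ?monic_exp.
  by rewrite -sum1_count -big_mkcondr.
have le_mL : (m.+1 <= L)%N by rewrite ltnS leq_addl.
transitivity (\sum_(k < m.+1) k * w k *
    \sum_(N < n.+1) (0 < N) * (k %| N) * nb_smooth m (n - N))%N.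
  rewrite (big_ord_widen L (fun k => k * w k * \sum_(N < n.+1)
    (0 < N) * (k %| N) * nb_smooth m (n - N))%N) // [RHS]big_mkcond /=.
  apply: eq_bigr => -[[|k] lt_kL] _ /=; first by rewrite !mul0n ?muln0 ?if_same.
  rewrite ltnS (sum_multiples (fun N => nb_smooth m (n - N))) //.
  by case: ifP => _; rewrite ?mul1n ?mul0n.
rewrite (eq_bigr (fun k : 'I_m.+1 => \sum_(N < n.+1)
  k * w k * ((0 < N) * (k %| N) * nb_smooth m (n - N)))%N); last first.
  by move=> k _; rewrite big_distrr.
rewrite exchange_big /=; apply: eq_bigr => N _.
rewrite /prime_weight big_distrr big_distrl /=; apply: eq_bigr => k _.
rewrite /w; ring.
Qed.

Lemma nb_smooth_all m n : (n <= m)%N -> nb_smooth m n = (q ^ n)%N.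
Proof.
move=> le_nm; rewrite -size_monics; apply/eqP; rewrite -all_count; apply/allP => f.
rewrite mem_monics => /andP[/monic_neq0 f0 /eqP sz_f]; apply/asboolP.
by apply: smooth_poly_deg; rewrite ?sz_f.
Qed.

Lemma prime_weight_small m N : (N <= m)%N -> prime_weight m N = prime_weight N N.
Proof.
move=> le_Nm; rewrite /prime_weight; case: posnP => [->|N0]; rewrite ?mul0n // !mul1n.
pose f k := ((k %| N) * (k * size (irreducibles k)))%N.
rewrite [RHS](big_ord_widen m.+1 f) // [RHS]big_mkcond /=; apply: eq_bigr => k _.
rewrite ltnS; case: leqP => // lt_Nk; rewrite (_ : (k %| N)%N = false) //.
by apply: gtnNdvd.
Qed.

(** Gauss's count of irreducible polynomials. For [m = n] every monic polynomial of
degree at most [n] is smooth, so [nb_smooth_rec] reads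
[n q^n = \sum_N w_N q^(n-N)], which determines the weights [w_N]. *)
Lemma prime_weight_full N : (0 < N)%N -> prime_weight N N = (q ^ N)%N.
Proof.
elim/ltn_ind: N => -[//|n] IH _; have := nb_smooth_rec n.+1 n.+1.
rewrite nb_smooth_all // big_ord_recr /= subnn nb_smooth_all // expn0 muln1.
rewrite big_ord_recl /= {1}/prime_weight mul0n add0n.
rewrite (eq_bigr (fun=> q ^ n.+1)%N).
  rewrite sum_nat_const card_ord mulSn addnC => /eqP; rewrite eqn_add2l => /eqP; exact.
move=> j _; rewrite /= /bump leq0n add1n prime_weight_small; last by have := ltn_ord j; lia.
have lt_jn := ltn_ord j; rewrite IH ?ltnS // nb_smooth_all ?leq_subr //.
by rewrite -expnD; congr (_ ^ _)%N; lia.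
Qed.

(** Every degree that occurs is a proper divisor of [N], hence at most [N/2], and
the irreducible polynomials of degree [k] have total degree at most [q^k]. *)
Lemma prime_weight_large m N : (m < N)%N -> (prime_weight m N <= 2 * q ^ N./2)%N.
Proof.
move=> lt_mN; rewrite /prime_weight (leq_ltn_trans (leq0n m) lt_mN) mul1n.
have q2 : (1 < q)%N by apply: finNzRing_gt1.
have geom i : (\sum_(k < i.+1) q ^ k <= 2 * q ^ i)%N.
  elim: i => [|i IH]; first by rewrite big_ord1.
  rewrite big_ord_recr /= expnS [leqRHS]mul2n -addnn leq_add2r.
  by apply: leq_trans IH _; rewrite leq_mul2r q2 orbT.
apply: leq_trans (geom _).
have term k : (k * size (irreducibles k) <= q ^ k)%N.
  case: k => [//|k]; rewrite -prime_weight_full // /prime_weight mul1n big_ord_recr /=.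
  by rewrite dvdnn mul1n leq_addl.
rewrite (big_ord_widen N.+1 (fun k => (k %| N) * (k * size (irreducibles k)))%N);
  last lia.
rewrite [leqRHS](big_ord_widen N.+1 (fun k => q ^ k)%N); last lia.
rewrite big_mkcond [leqRHS]big_mkcond /=; apply: leq_sum => k _; rewrite !ltnS.
case: (leqP k m) => // le_km; have [dvd_kN|] := boolP (k %| N)%N; last by rewrite mul0n.
(* a proper divisor of N is at most N/2 *)
rewrite ifT ?mul1n //; case/dvdnP: dvd_kN => -[|[|d]]; nia.
Qed.

End Monics.

Lemma prob_smooth_polyE (R : realType) (F : finFieldType) m n :
  prob_smooth_poly R F n m = (nb_smooth F m n)%:R / #|F|%:R ^+ n.
Proof.
rewrite /prob_smooth_poly /Defs.uniform_prob -natrX -size_monics /monics size_map -cardE.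
congr (_%:R / _); rewrite /nb_smooth count_map -size_filter cardE; apply/perm_size.
apply: uniq_perm; [exact: enum_uniq|exact/filter_uniq/enum_uniq|].
by move=> f; rewrite [in RHS]mem_filter !mem_enum inE /= andbC.
Qed.

Lemma smooth_poly_exp_coefs (R : realType) (F : finFieldType) m :
  exp_coefs (fun N => (prime_weight F m N)%:R / #|F|%:R ^+ N : R)
    (fun n => prob_smooth_poly R F n m).
Proof.
have q0 : #|F|%:R != 0 :> R by rewrite pnatr_eq0 -lt0n ltnW // finNzRing_gt1.
split=> [|n]; first by rewrite prob_smooth_polyE nb_smooth_all // expn0 expr0 divr1.
rewrite prob_smooth_polyE mulrA -natrM nb_smooth_rec natr_sum mulr_suml.
apply: eq_bigr => N _; rewrite prob_smooth_polyE natrM.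
have -> : #|F|%:R ^+ n = #|F|%:R ^+ N * #|F|%:R ^+ (n - N) :> R.
  by rewrite -exprD subnKC // -ltnS.
by field; rewrite !expf_neq0.
Qed.

(** * Log-concavity and growth of the smooth permutation probabilities *)

Section DickmanSequence.
Variables (R : realType) (m : nat) (p : nat -> R).
Hypothesis m_gt0 : (0 < m)%N.
Hypothesis hp : exp_coefs (fun j => (0 < j <= m)%N%:R) p.

(** The discrete form of the equation [u rho(u) = \int_(u-1)^u rho] of the Dickman
function, which describes [p n] in the limit [n = u m]. *)
Lemma dickman_rec n : n.+1%:R * p n.+1 = \sum_(i < n.+1) (i < m)%N%:R * p (n - i)%N.
Proof.
have [_ ->] := hp; rewrite big_ord_recl mul0r add0r; apply: eq_bigr => i _.
by rewrite /= /bump leq0n add1n subSS.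
Qed.

(** Subtract two consecutive instances of the recurrence: the two windows of
length [m] differ only in their end points. *)
Lemma dickman_step n : n.+1%:R * p n.+1 = n.+1%:R * p n - (m <= n)%N%:R * p (n - m)%N.
Proof.
apply/eqP; rewrite eq_sym subr_eq dickman_rec -(@natr1 _ n) mulrDl mul1r; have [_ ->] := hp.
have -> : p n = \sum_(i < n.+1) (i == 0 :> nat)%:R * p (n - i)%N.
  rewrite big_ord_recl /= mul1r subn0 big1 ?addr0 // => i _.
  by rewrite mul0r.
have -> : (m <= n)%N%:R * p (n - m)%N = \sum_(i < n.+1) (i == m :> nat)%:R * p (n - i)%N.
  have [le_mn|lt_nm] := leqP m n; last first.
    rewrite mul0r big1 // => i _; rewrite ltn_eqF ?mul0r //.
    by have := ltn_ord i; rewrite ltnS => /leq_ltn_trans; apply.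
  rewrite (bigD1 (Ordinal (le_mn : (m < n.+1)%N))) //= eqxx big1 ?addr0 //.
  by move=> i /eqP neq_im; case: eqP => [eq_im|]; [case: neq_im; apply: val_inj|rewrite mul0r].
rewrite -!big_split /=; apply/eqP/eq_bigr => i _; rewrite -!mulrDl; congr (_ * _).
by rewrite -!natrD; congr (_%:R); lia.
Qed.

Lemma dickman_gt0 n : 0 < p n.
Proof.
elim/ltn_ind: n => -[|n] IH; first by case: hp => ->.
rewrite -(pmulr_rgt0 _ (ltr0Sn R n)) dickman_rec big_ord_recl /= m_gt0 mul1r subn0.
apply: ltr_wpDr; last exact: IH.
by apply: sumr_ge0 => i _; rewrite mulr_ge0 // ltW // IH //; lia.
Qed.

Lemma dickman_nincr n : p n.+1 <= p n.
Proof.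
rewrite -(ler_pM2l (ltr0Sn R n)) dickman_step lerBlDr lerDl mulr_ge0 //.
exact/ltW/dickman_gt0.
Qed.

Lemma dickman_window n : (m <= n)%N -> n%:R * p n = \sum_(i < m) p (n - i.+1)%N.
Proof.
case: n => [|n] le_mn; first by rewrite leqNgt m_gt0 in le_mn.
rewrite dickman_rec (big_ord_widen n.+1 (fun i => p (n.+1 - i.+1)%N)) //.
rewrite [RHS]big_mkcond; apply: eq_bigr => i _.
by rewrite subSS; case: ifP; rewrite ?mul1r ?mul0r.
Qed.

(** Log-concavity is only assumed below [N], for use inside the induction that
proves it. *)
Lemma log_concave_upto N a b :
  (forall k, (k < N)%N -> p k * p k.+2 <= p k.+1 ^+ 2) -> (b <= a <= N)%N ->
  p a.+1 * p b <= p a * p b.+1.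
Proof.
move=> LC; elim: a => [|a IH] /andP[le_ba le_aN].
  by move: le_ba; rewrite leqn0 => /eqP ->; rewrite mulrC.
move: le_ba; rewrite leq_eqVlt => /predU1P[->|]; first by rewrite mulrC.
rewrite ltnS => le_ba; have {}IH : p a.+1 * p b <= p a * p b.+1.
  by apply: IH; rewrite le_ba ltnW.
rewrite -(ler_pM2l (dickman_gt0 a)) mulrA.
apply: (@le_trans _ _ (p a.+1 ^+ 2 * p b)).
  by rewrite ler_wpM2r ?LC // ltW // dickman_gt0.
by rewrite expr2 -mulrA [leRHS]mulrCA ler_wpM2l // ltW // dickman_gt0.
Qed.

(** For [n >= m] the claim is, by [dickman_step],
[p_(n+1) p_(n-m) / (n+1) <= p_n p_(n+1-m) / (n+2)]. Expand [n p_n] and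
[(n+1) p_(n+1)] by [dickman_window] and compare termwise, using log-concavity at
smaller indices. The comparison gives the factors [n] and [n+1] instead of [n+1]
and [n+2], which is stronger because [n (n+2) <= (n+1)^2]. *)
Lemma dickman_log_concave n : p n * p n.+2 <= p n.+1 ^+ 2.
Proof.
elim/ltn_ind: n => n IH.
have step1 := dickman_step n; have step2 := dickman_step n.+1.
have A_gt0 := dickman_gt0 n; have B_gt0 := dickman_gt0 n.+1.
have [le_mn|lt_nm] := leqP m n; last first.
  have eqAB : p n.+1 = p n.
    apply: (@mulfI _ n.+1%:R); first by rewrite pnatr_eq0.
    by rewrite step1 leqNgt lt_nm mul0r subr0.
  by rewrite -eqAB expr2 ler_pM2l // dickman_nincr.
have n_gt0 : (0 < n)%N by apply: leq_trans le_mn.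
rewrite le_mn mul1r in step1; rewrite (leqW le_mn) mul1r subSn // in step2.
have U_gt0 := dickman_gt0 (n - m); have V_gt0 := dickman_gt0 (n - m).+1.
have key : n.+1%:R * p n.+1 * p (n - m)%N <= n%:R * p n * p (n - m).+1.
  rewrite !dickman_window ?(leqW le_mn) // !mulr_suml; apply: ler_sum => i _.
  have lt_im := ltn_ord i; rewrite subSS -subnSK; last exact: leq_trans le_mn.
  by apply: (log_concave_upto (N := n)) => //; lia.
move: (p n) (p n.+1) (p n.+2) (p (n - m)%N) (p (n - m).+1) A_gt0 B_gt0 U_gt0 V_gt0
  step1 step2 key => A B D U V A_gt0 B_gt0 U_gt0 V_gt0.
have x_gt0 : 0 < n%:R :> R by rewrite ltr0n.
rewrite -!natr1; move: (n%:R : R) x_gt0 => x x_gt0 step1 step2 key.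
have key2 : (x + 1 + 1) * (B * U) <= (x + 1) * (A * V).
  rewrite -(ler_pM2l x_gt0).
  have BU : 0 < B * U by exact: mulr_gt0.
  have := ler_wpM2l (_ : 0 <= x + 1) key; nra.
have x1 : 0 < x + 1 by lra.
have x2 : 0 < x + 1 + 1 by lra.
rewrite -(ler_pM2l x1) -(ler_pM2l x2).
have -> : (x + 1 + 1) * ((x + 1) * (A * D)) = (x + 1) * A * ((x + 1 + 1) * D) by ring.
have -> : (x + 1 + 1) * ((x + 1) * B ^+ 2) = (x + 1 + 1) * B * ((x + 1) * B) by ring.
rewrite step1 step2; nra.
Qed.

Let G k := p k / p k.+1.

Lemma ratio_incr a b : (b <= a)%N -> G b <= G a.
Proof.
move=> le_ba; rewrite /G ler_pdivrMr ?dickman_gt0 // mulrAC ler_pdivlMr ?dickman_gt0 //.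
rewrite mulrC; apply: (log_concave_upto (N := a)); last by rewrite le_ba /=.
by move=> k _; exact: dickman_log_concave.
Qed.

Lemma ratio_lower y b j : 0 <= y -> y <= G b -> y ^+ j * p (b + j)%N <= p b.
Proof.
move=> y0 leyG; elim: j => [|j IH]; first by rewrite expr0 mul1r addn0.
apply: le_trans IH; rewrite exprSr -mulrA ler_wpM2l ?exprn_ge0 // addnS.
by rewrite -ler_pdivlMr ?dickman_gt0 // (le_trans leyG) // ratio_incr ?leq_addr.
Qed.

Lemma ratio_upper y b j : G (b + j) <= y -> p b <= y ^+ j * p (b + j)%N.
Proof.
move=> leGy; have y0 : 0 <= y by rewrite (le_trans _ leGy) // divr_ge0 ?ltW ?dickman_gt0.
elim: j leGy => [|j IH] leGy; first by rewrite expr0 mul1r addn0.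
apply: le_trans (IH _) _; first by apply: le_trans leGy; rewrite ratio_incr // addnS.
rewrite exprSr -mulrA ler_wpM2l ?exprn_ge0 // addnS.
rewrite -ler_pdivrMr ?dickman_gt0 //; apply: le_trans leGy; rewrite addnS.
exact: ratio_incr.
Qed.

Section AtN.
Variable n : nat.
Hypothesis le_mn : (m <= n)%N.
Let X := p (n - m)%N / p n.
Let Y := expR (ln X / m%:R).
Let n_gt0 : 0 < n%:R :> R.
Proof. by rewrite ltr0n (leq_trans m_gt0). Qed.

Lemma dickman_anti a b : (a <= b)%N -> p b <= p a.
Proof.
move=> /subnK <-; elim: (b - a)%N => // k IH; exact: le_trans (dickman_nincr _) IH.
Qed.

Lemma window_ratio_ge1 : 1 <= X.
Proof. by rewrite /X ler_pdivlMr ?dickman_gt0 // mul1r dickman_anti ?leq_subr. Qed.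

Let X_gt0 : 0 < X. Proof. exact: lt_le_trans window_ratio_ge1. Qed.

Lemma window_ratio_le : X <= n%:R.
Proof.
rewrite /X ler_pdivrMr ?dickman_gt0 // dickman_window //.
rewrite (bigD1 (Ordinal (_ : m.-1 < m)%N)) //=; first by rewrite prednK.
move=> lt_m; rewrite prednK // lerDl; apply: sumr_ge0 => i _.
exact/ltW/dickman_gt0.
Qed.

Let Y_ge1 : 1 <= Y.
Proof. by rewrite -expR0 ler_expR divr_ge0 ?ln_ge0 ?window_ratio_ge1. Qed.

Let YX : Y ^+ m = X.
Proof.
by rewrite -expRM_natl mulrCA mulfV ?mulr1 ?lnK // pnatr_eq0 -lt0n.
Qed.

(** A log-concave sequence lies above the geometric one with the same values at
[n] and [n - m]. According to the side of [Y] on which the ratio at [n - j] falls,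
compare with one or the other end point. *)
Lemma powers_below_chord j : (j <= m)%N -> Y ^+ j * p n <= p (n - j)%N.
Proof.
move=> le_jm; have Y_gt0 : 0 < Y by exact: lt_le_trans Y_ge1.
have njj : (n - j + j = n)%N by rewrite subnK // (leq_trans le_jm).
have [leYG|/ltW leGY] := leP Y (G (n - j)).
  by have := ratio_lower j (ltW Y_gt0) leYG; rewrite njj.
have nmj : (n - m + (m - j) = n - j)%N by lia.
have := @ratio_upper Y (n - m) (m - j); rewrite nmj => /(_ leGY).
have -> : p (n - m)%N = Y ^+ m * p n by rewrite YX /X divfK // gt_eqF // dickman_gt0.
by rewrite -{1}(subnKC le_jm) addnC exprD -mulrA ler_pM2l // exprn_gt0.
Qed.

(** The inequality [Y + ... + Y^m <= n], multiplied by [Y - 1]. *)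
Lemma geometric_sum_le : (X - 1) * Y <= n%:R * (Y - 1).
Proof.
have Yle : \sum_(i < m) Y ^+ i.+1 <= n%:R.
  rewrite -(ler_pM2r (dickman_gt0 n)) dickman_window // mulr_suml.
  by apply: ler_sum => i _; apply: powers_below_chord.
rewrite -YX subrX1 -mulrA mulr_suml mulrC.
under eq_bigr => i _ do rewrite -exprSr.
by rewrite ler_wpM2r // subr_ge0.
Qed.

(** Divide [geometric_sum_le] by [Y] and use [1 - 1/Y <= ln Y = ln X / m]. *)
Lemma window_ratio_log : X - 1 <= n%:R / m%:R * ln X.
Proof.
have Y_gt0 : 0 < Y by exact: lt_le_trans Y_ge1.
have := geometric_sum_le; rewrite -ler_pdivlMr // => /le_trans; apply.
rewrite -!mulrA ler_wpM2l ?ler0n // mulrBl mul1r mulfV ?gt_eqF //.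
rewrite /Y -expRN [X in _ <= X]mulrC.
have := expR_ge1Dx (- (ln X / m%:R)); lra.
Qed.

(** By [dickman_step], [p_n / p_(n+1) = (n+1) / (n+1-X)], and [geometric_sum_le] says
that [Y (n+1-X) >= n]. *)
Lemma step_ratio_le_window : G n <= (1 + n%:R^-1) * Y.
Proof.
have Y_gt0 : 0 < Y by exact: lt_le_trans Y_ge1.
have := dickman_step n; rewrite le_mn mul1r => step.
have pn := dickman_gt0 n; have pn1 := dickman_gt0 n.+1.
have eqX : p (n - m)%N = X * p n by rewrite /X divfK // gt_eqF.
rewrite /G ler_pdivrMr // -(ler_pM2l n_gt0).
have -> : n%:R * ((1 + n%:R^-1) * Y * p n.+1) = Y * (n.+1%:R * p n.+1).
  by rewrite -natr1; field; rewrite gt_eqF.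
rewrite step eqX -natr1; have := geometric_sum_le; nra.
Qed.

End AtN.
End DickmanSequence.

(** * Comparison of the two probabilities *)

Section Estimates.
Variable R : realType.

(** The hypothesis [6 ln n <= m] will give [r <= exp (1/3)]; the geometric decay
relies on [exp (2/3)] being less than [2], the smallest possible [q]. *)
Lemma expR_two_thirds : expR (2 / 3) <= 99 / 50 :> R.
Proof.
(* 1 - x <= exp (-x) at x = 1/21 gives exp (1/21) <= 21/20, and
   (21/20)^14 is about 1.9799 *)
have -> : 2 / 3 = 14%:R * (1 / 21) :> R by lra.
rewrite expRM_natl.
have e_gt0 := expR_gt0 (1 / 21 : R).
have le1 : expR (1 / 21) <= 21 / 20 :> R.
  have := expR_ge1Dx (- (1 / 21) : R); rewrite expRN => le_inv.
  have : 20 / 21 * expR (1 / 21) <= 1 :> R.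
    rewrite -ler_pdivlMr //; lra.
  lra.
apply: le_trans (_ : (21 / 20 : R) ^+ 14 <= _).
  by apply: lerXn2r; rewrite ?nnegrE //; lra.
lra.
Qed.

Lemma ln2_ge : 2 / 3 <= ln 2 :> R.
Proof.
rewrite -ler_expR lnK ?posrE; last lra.
have := expR_two_thirds; lra.
Qed.

Lemma ln_le_subr1 (z : R) : 0 < z -> ln z <= z - 1.
Proof.
by move=> z0; have := expR_ge1Dx (ln z); rewrite lnK ?posrE //; lra.
Qed.

(** Bound [ln X] by its tangent at [2 u], which absorbs half of [X], and use
[2 u <= (u + 1)^2]. *)
Lemma log_ineq_solve (u X : R) : 1 <= u -> 0 < X -> X - 1 <= u * ln X ->
  X <= 4 * (u * ln (u + 1)).
Proof.
move=> u1 X0 leX; have u0 : 0 < u by lra.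
have lnX : ln X <= X / (2 * u) - 1 + ln (2 * u).
  have X2u : 0 < X / (2 * u) by rewrite divr_gt0 ?mulr_gt0.
  have := ln_le_subr1 X2u; rewrite ln_div ?posrE ?mulr_gt0 //; lra.
have ln2u : ln (2 * u) <= 2 * ln (u + 1).
  have -> : 2 * ln (u + 1) = ln ((u + 1) ^+ 2).
    by rewrite lnXn; [rewrite mulr_natl|lra].
  by rewrite ler_ln ?posrE ?exprn_gt0 ?mulr_gt0 //; nra.
have : X - 1 <= X / 2 - u + u * (2 * ln (u + 1)).
  apply: le_trans leX _.
  apply: le_trans (_ : u * (X / (2 * u) - 1 + 2 * ln (u + 1)) <= _).
    by rewrite ler_wpM2l //; lra.
  have -> : u * (X / (2 * u) - 1 + 2 * ln (u + 1)) = X / 2 - u + u * (2 * ln (u + 1)).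
    by field; rewrite gt_eqF.
  exact: lexx.
lra.
Qed.

(** Two consecutive exponents multiply the term by [x^2 / q <= 99/100]; the two-step
decay is turned into one of ratio [199/200], as [(199/200)^2 >= 99/100]. *)
Lemma sum_geometric_tail (x q : R) M K : 0 <= x -> x ^+ 2 <= 99 / 50 -> 2 <= q ->
  \sum_(i < K) x ^+ (M + i) / q ^+ uphalf (M + i) <= 400 * (x ^+ M / q ^+ uphalf M).
Proof.
move=> x0 x2 q2; have q0 : 0 < q by lra.
pose t i := x ^+ (M + i) / q ^+ uphalf (M + i).
have t_ge0 i : 0 <= t i by apply: divr_ge0; apply: exprn_ge0 => //; exact: ltW.
have x32 : x <= 3 / 2 by nra.
pose tau : R := 199 / 200.
have two_step i : t i.+2 <= tau ^+ 2 * t i.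
  have -> : t i.+2 = x ^+ 2 / q * t i.
    rewrite /t !addnS /= !exprS; field.
    by rewrite ?expf_neq0 ?lt0r_neq0.
  rewrite ler_wpM2r // ler_pdivrMr // /tau; nra.
have decay i : t i <= 2 * tau ^+ i * t 0%N /\ t i.+1 <= 2 * tau ^+ i.+1 * t 0%N.
  elim: i => [|i [IH1 IH2]]; split=> //.
  - by rewrite expr0; have := t_ge0 0%N; lra.
  - apply: le_trans (_ : x * t 0%N <= _).
      rewrite /t addnS addn0 exprS -mulrA ler_wpM2l // ler_wpM2l ?exprn_ge0 //.
      rewrite lef_pV2 ?posrE ?exprn_gt0 // ler_weXn2l //; first lra.
      by rewrite -addn1 uphalf_half; lia.
    by rewrite expr1 /tau; have := t_ge0 0%N; nra.
  - apply: le_trans (two_step i) _; rewrite (_ : tau ^+ i.+2 = tau ^+ 2 * tau ^+ i); last first.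
      by rewrite -exprD.
    have : 0 <= tau ^+ 2 by rewrite exprn_ge0 // /tau; lra.
    nra.
have tau0 : 0 <= tau by rewrite /tau; lra.
have geom : \sum_(i < K) tau ^+ i <= 200.
  have := subrX1 tau K; have := exprn_ge0 K tau0.
  by move: (\sum_(i < K) _) (tau ^+ K) => s y; rewrite /tau => y0 e; nra.
apply: le_trans (_ : \sum_(i < K) 2 * tau ^+ i * t 0%N <= _).
  by apply: ler_sum => i _; case: (decay i).
rewrite -mulr_suml -mulr_sumr /t addn0.
have := t_ge0 0%N; rewrite /t addn0; nra.
Qed.

End Estimates.

Section Comparison.
Variables (R : realType) (n m : nat).
Hypotheses (n_ge2 : (2 <= n)%N) (m_bounds : (1 <= m <= n)%N).
Hypothesis m_large : 6%:R * ln (n%:R : R) <= m%:R.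

Let m_gt0 : (0 < m)%N. Proof. by case/andP: m_bounds. Qed.
Let le_mn : (m <= n)%N. Proof. by case/andP: m_bounds. Qed.
Let mR_gt0 : 0 < m%:R :> R. Proof. by rewrite ltr0n. Qed.
Let nR_gt0 : 0 < n%:R :> R. Proof. by rewrite ltr0n ltnW. Qed.

(** As [m <= n], the hypothesis [6 ln n <= m] excludes small [n]: from [ln 2 >= 2/3]
first [n >= 4], and then [n >= 6 ln 4 >= 8]. *)
Lemma length_ge8 : (8 <= n)%N.
Proof.
have ln2 := ln2_ge R.
have le_mnR : m%:R <= n%:R :> R by rewrite ler_nat.
have lb k : (0 < k)%N -> (k <= n)%N -> ln k%:R <= ln n%:R :> R.
  by move=> k0 le_kn; rewrite ler_ln ?posrE ?ltr0n ?ler_nat // ltnW.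
have n_ge4 : (4 <= n)%N.
  rewrite -(ler_nat R); apply: le_trans le_mnR; apply: le_trans m_large.
  have := lb 2%N isT n_ge2; lra.
rewrite -(ler_nat R); apply: le_trans le_mnR; apply: le_trans m_large.
have := lb 4%N isT n_ge4; have -> : 4%:R = 2 ^+ 2 :> R by rewrite -natrX.
rewrite lnXn // mulr2n; lra.
Qed.

Variable p : nat -> R.
Hypothesis hp : exp_coefs (fun j => (0 < j <= m)%N%:R) p.
Let X := p (n - m)%N / p n.
Let r := p n / p n.+1.

Let p_gt0 k : 0 < p k. Proof. exact: (dickman_gt0 m_gt0 hp). Qed.

Lemma step_ratio_le_expR : r <= expR (n%:R^-1 + ln X / m%:R).
Proof.
apply: le_trans (step_ratio_le_window m_gt0 hp le_mn) _.
rewrite expRD ler_wpM2r ?expR_ge0 // expR_ge1Dx //.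
Qed.

Lemma step_ratio_ge1 : 1 <= r.
Proof. by rewrite /r ler_pdivlMr // mul1r (dickman_nincr m_gt0 hp). Qed.

(** Here [1/n <= 1/8] and [ln X / m <= ln n / m <= 1/6], with sum less than
[1/3]. *)
Lemma step_ratio_sqr_le : r ^+ 2 <= 99 / 50.
Proof.
have X1 := window_ratio_ge1 m_gt0 hp n; have Xn := window_ratio_le m_gt0 hp le_mn.
apply: le_trans (expR_two_thirds R).
have -> : 2 / 3 = 2%:R * (1 / 3) :> R by lra.
rewrite expRM_natl lerXn2r ?nnegrE ?expR_ge0 //; first by have := step_ratio_ge1; lra.
apply: le_trans step_ratio_le_expR _; rewrite ler_expR.
have : n%:R^-1 <= 8^-1 :> R by rewrite lef_pV2 ?posrE // ler_nat length_ge8.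
have : ln X / m%:R <= 6^-1.
  rewrite ler_pdivrMr //.
  have ml : 6 * ln n%:R <= m%:R :> R := m_large.
  have : ln X <= ln n%:R by rewrite ler_ln ?posrE // (lt_le_trans ltr01).
  lra.
lra.
Qed.

(** [r^m <= exp (m/n) X <= 4 X], and [log_ineq_solve] bounds [X]; here the factor
[4] is enough as [m <= n] and [exp 1 <= exp (2/3)^2 < 4]. *)
Lemma step_ratio_pow_le :
  r ^+ m <= 16 * (n%:R / m%:R * ln (n%:R / m%:R + 1)).
Proof.
have X1 := window_ratio_ge1 m_gt0 hp n; have X0 : 0 < X by apply: lt_le_trans X1.
have u1 : 1 <= n%:R / m%:R :> R by rewrite ler_pdivlMr // mul1r ler_nat.
have le_X := log_ineq_solve u1 X0 (window_ratio_log m_gt0 hp le_mn).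
apply: le_trans (_ : 4 * X <= _); last lra.
apply: le_trans (_ : expR (n%:R^-1 + ln X / m%:R) ^+ m <= _).
  rewrite lerXn2r ?nnegrE ?expR_ge0 ?step_ratio_le_expR //; have := step_ratio_ge1; lra.
rewrite -expRM_natl mulrDr expRD mulrCA mulfV ?gt_eqF // mulr1 lnK ?posrE //.
rewrite ler_wpM2r //; first exact: ltW.
apply: le_trans (_ : expR (2 / 3) ^+ 2 <= _); last first.
  have := expR_two_thirds R; have := expR_ge0 (2 / 3 : R); nra.
rewrite -expRM_natl ler_expR.
have : m%:R / n%:R <= 1 :> R by rewrite ler_pdivrMr // mul1r ler_nat.
lra.
Qed.

Variables (q : R) (b P : nat -> R).
Hypothesis q_ge2 : 2 <= q.
Let q_gt0 : 0 < q. Proof. by apply: lt_le_trans q_ge2; exact: ltr0n. Qed.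
Hypothesis b_small : forall N, (N <= m)%N -> b N = (0 < N)%N%:R.
Hypothesis b_large : forall N, (m < N)%N -> 0 <= b N <= 2 / q ^+ uphalf N.
Hypothesis hP : exp_coefs b P.

(** The part of the exponent that polynomials have and permutations do not. *)
Let a N := if (m < N)%N then b N else 0.
Let S := \sum_(N < n.+1) a N * r ^+ N / N%:R.

Let a_ge0 N : 0 <= a N.
Proof. by rewrite /a; case: ifP => // /b_large/andP[]. Qed.

(** The coefficients of [exp (\sum_N b_N X^N / N)] are the Cauchy product of [p] with
those of the exponential of the tail, and [p (n - k) <= r ^+ k * p n]. *)
Lemma quotient_between : 1 <= P n / p n <= expR S.
Proof.
have a0 : a 0%N = 0 by [].
have [e he] := exp_coefs_exist a0.
have b0 : b 0%N = 0 by rewrite b_small.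
have -> : P n = \sum_(k < n.+1) e k * p (n - k)%N.
  have [c0 hc] := exp_coefs_mul he hp; have [P0 recP] := hP.
  apply: (exp_coefs_uniq (a := b) (n := n) (E := P)
    (E' := fun k => \sum_(j < k.+1) e j * p (k - j)%N)) => //; first by rewrite c0.
  move=> k _; rewrite hc; apply: eq_bigr => j _; congr (_ * _).
  rewrite /a; case: ltnP => [lt_mj|le_jm]; last by rewrite add0r b_small // andbT.
  by rewrite andbF addr0.
have e_ge0 := exp_coefs_ge0 a_ge0 a0 he.
apply/andP; split.
  rewrite ler_pdivlMr // mul1r big_ord_recl subn0 he.1 mul1r lerDl.
  by apply: sumr_ge0 => k _; rewrite mulr_ge0 // ltW.
have hw := exp_coefs_scale r he.
have r_ge0 : 0 <= r by have := step_ratio_ge1; lra.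
apply: le_trans (_ : \sum_(k < n.+1) e k * r ^+ k <= _); last first.
  apply: (sum_exp_coefs_le _ _ _ hw); last by rewrite a0 mul0r.
  by move=> j; rewrite mulr_ge0 ?exprn_ge0.
rewrite ler_pdivrMr // mulr_suml; apply: ler_sum => k _.
rewrite -mulrA ler_wpM2l //.
have le_kn : (k <= n)%N by rewrite -ltnS.
have := @ratio_upper _ _ _ m_gt0 hp r (n - k) k; rewrite subnK //.
by apply.
Qed.

(** For [N > m] the term is at most [2 / m] times [r^N / q^(ceil (N/2))], and these
decay geometrically from [N = m + 1] on. *)
Lemma tail_exponent_le : S <= 1200 * (r ^+ m / (m%:R * q ^+ uphalf m.+1)).
Proof.
have r1 := step_ratio_ge1; have r_ge0 : 0 <= r by lra.
have r32 : r <= 3 / 2 by have := step_ratio_sqr_le; nra.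
have sumE : S = \sum_(i < n - m) a (m.+1 + i)%N * r ^+ (m.+1 + i) / (m.+1 + i)%:R.
  rewrite /S -(big_mkord predT (fun N => a N * r ^+ N / N%:R)).
  rewrite (@big_cat_nat _ _ _ m.+1) //= big_nat big1 ?add0r.
    by rewrite -{1}[m.+1]add0n big_addn big_mkord subSS; under eq_bigr do rewrite addnC.
  by move=> N /andP[_]; rewrite ltnS /a ltnNge => ->; rewrite !mul0r.
rewrite sumE.
apply: le_trans (_ : \sum_(i < n - m) 2 / m%:R *
    (r ^+ (m.+1 + i) / q ^+ uphalf (m.+1 + i)) <= _).
  apply: ler_sum => i _; set N := (m.+1 + i)%N.
  have lt_mN : (m < N)%N by rewrite /N addSn ltnS leq_addr.
  rewrite /a lt_mN; have /andP[bN0 bN] := b_large lt_mN.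
  have -> : 2 / m%:R * (r ^+ N / q ^+ uphalf N) = 2 / q ^+ uphalf N * r ^+ N / m%:R.
    by rewrite mulrACA [RHS]mulrAC; ring.
  apply: ler_pM; rewrite ?invr_ge0 ?mulr_ge0 ?exprn_ge0 //.
    by rewrite ler_wpM2r ?exprn_ge0.
  by rewrite lef_pV2 ?posrE ?ltr0n // ?ler_nat 1?ltnW // (leq_trans _ lt_mN).
rewrite -mulr_sumr.
apply: le_trans (_ : 2 / m%:R * (400 * (r ^+ m.+1 / q ^+ uphalf m.+1)) <= _).
  rewrite ler_wpM2l ?divr_ge0 // sum_geometric_tail //.
  exact: step_ratio_sqr_le.
have -> : 2 / m%:R * (400 * (r ^+ m.+1 / q ^+ uphalf m.+1)) =
    800 * r * (r ^+ m / (m%:R * q ^+ uphalf m.+1)).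
  rewrite exprS; field; rewrite ?expf_neq0 ?lt0r_neq0 //.
rewrite ler_wpM2r //; last lra.
by rewrite divr_ge0 ?mulr_ge0 ?exprn_ge0 // ltW.
Qed.

(** [m <= 2 ceil ((m+1)/2)] and [r^2 <= q]. *)
Lemma tail_exponent_scale_le1 : r ^+ m / (m%:R * q ^+ uphalf m.+1) <= 1.
Proof.
have r1 := step_ratio_ge1; rewrite ler_pdivrMr ?mulr_gt0 ?exprn_gt0 // mul1r.
apply: le_trans (_ : q ^+ uphalf m.+1 <= _); last first.
  by rewrite ler_peMl ?exprn_ge0 ?(ltW q_gt0) // ler1n.
apply: le_trans (_ : (r ^+ 2) ^+ uphalf m.+1 <= _).
  by rewrite -exprM ler_weXn2l // uphalf_half; lia.
rewrite lerXn2r ?nnegrE ?exprn_ge0 ?(ltW q_gt0) //; first lra.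
apply: le_trans q_ge2; have := step_ratio_sqr_le; lra.
Qed.

(** With [w = r^m / (m q^(ceil ((m+1)/2)))] the quotient is at most [exp (K w)];
conclude by [exp s - 1 <= s exp s], [w <= 1] and the bound on [r^m]. *)
Lemma ratio_bound (K : R) : 1200 <= K ->
  `| P n / p n - 1 | <= 16 * K * expR K *
    (n%:R / m%:R * ln (n%:R / m%:R + 1) / (m%:R * q ^+ uphalf m.+1)).
Proof.
move=> K_ge; set u := n%:R / m%:R; have /andP[ge1 le_exp] := quotient_between.
have mq0 : 0 < m%:R * q ^+ uphalf m.+1 by rewrite mulr_gt0 ?exprn_gt0.
have w0 : 0 <= r ^+ m / (m%:R * q ^+ uphalf m.+1).
  by rewrite divr_ge0 ?exprn_ge0 ?(ltW mq0) // (le_trans ler01) ?step_ratio_ge1.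
have lew : r ^+ m / (m%:R * q ^+ uphalf m.+1) <=
    16 * (u * ln (u + 1) / (m%:R * q ^+ uphalf m.+1)).
  by rewrite mulrA ler_pM2r ?invr_gt0 // step_ratio_pow_le.
rewrite ger0_norm ?subr_ge0 //.
have w1 := tail_exponent_scale_le1; have leS := tail_exponent_le.
move: (r ^+ m / _) (u * _ / _) w0 lew w1 leS => w v w0 lew w1 leS.
have K0 : 0 <= K by apply: le_trans K_ge; exact: ler0n.
have {}leS : S <= K * w by apply: le_trans leS _; exact: ler_wpM2r.
apply: le_trans (_ : expR (K * w) - 1 <= _).
  by rewrite lerD2r (le_trans le_exp) // ler_expR.
apply: le_trans (_ : K * w * expR (K * w) <= _).
  have := expR_ge1Dx (- (K * w)); rewrite expRN.
  rewrite -(ler_pM2r (expR_gt0 (K * w))) mulVf ?gt_eqF ?expR_gt0 //; lra.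
apply: le_trans (_ : K * w * expR K <= _).
  by rewrite ler_wpM2l ?mulr_ge0 // ler_expR ler_piMr.
have -> : 16 * K * expR K * v = K * (16 * v) * expR K by ring.
by rewrite ler_wpM2r ?expR_ge0 // ler_wpM2l.
Qed.

End Comparison.

Theorem theorem1p1 (R : realType) :
  exists C : R, 0 < C /\
    forall (F : finFieldType) (q n m : nat),
      #|F| = q ->
      (2 <= n)%N -> (1 <= m <= n)%N ->
      6%:R * ln (n%:R : R) <= m%:R ->
      let u : R := n%:R / m%:R in
      `| prob_smooth_poly R F n m / prob_smooth_perm R n m - 1 |
        <= C * (u * ln (u + 1) / (m%:R * q%:R ^+ uphalf m.+1)).
Proof.
(* an abstract K prevents conversion from unfolding the numeral 1200 *)
have [K K_ge] : exists K : R, 1200 <= K by exists 1200.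
have K0 : 0 < K by apply: lt_le_trans K_ge; exact: ltr0n.
exists (16 * K * expR K); split; first by rewrite !mulr_gt0 ?expR_gt0.
move=> F q n m <- n2 mb m_large.
have [p hp] := @exp_coefs_exist R (fun j => (0 < j <= m)%N%:R) erefl.
rewrite (prob_smooth_permE n hp).
have q2 : (2 <= #|F|)%N by apply: finNzRing_gt1.
have q0 : #|F|%:R != 0 :> R by rewrite pnatr_eq0 -lt0n ltnW.
apply: (ratio_bound n2 mb m_large hp _ _ _ (smooth_poly_exp_coefs R F m) K_ge).
- by rewrite (ler_nat _ 2).
- move=> N le_Nm; have [->|N0] := posnP N; first by rewrite /prime_weight mul0n mul0r.
  by rewrite prime_weight_small // prime_weight_full // natrX divff ?expf_neq0.
move=> N lt_mN; apply/andP; split; first by rewrite divr_ge0 ?exprn_ge0.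
rewrite ler_pdivrMr ?exprn_gt0 ?lt0r ?q0 ?ler0n //.
rewrite mulrAC ler_pdivlMr ?exprn_gt0 ?lt0r ?q0 ?ler0n //.
apply: le_trans (_ : (2 * #|F| ^ N./2)%N%:R * #|F|%:R ^+ uphalf N <= _).
  by rewrite ler_wpM2r ?exprn_ge0 // ler_nat prime_weight_large.
rewrite natrM natrX -mulrA -exprD.
by have -> : (N./2 + uphalf N = N)%N by rewrite uphalf_half; have := odd_double_half N; lia.
Qed.
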